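(* For every $\varepsilon > 0$ there exist $n_0$ and $\delta > 0$ such that if $G$ is a graph on $n \ge n_0$ vertices with $w_T(G) \ge \frac12 - \delta$, then $G$ is within edit distance at most $\varepsilon n^2$ of some Turán graph $T(n,k)$ (for some positive integer $k$).
   Context: For a graph $G$ and an edge $e \in E(G)$, let $r(e)$ be the order of a largest clique of $G$ containing $e$. The Turán weights are $w_T(r) := \frac{r}{2(r-1)}$ for integers $r \ge 2$, and each edge $e$ is given weight $w_T(e) := w_T(r(e))$. For an $n$-vertex graph $G$, $w_T(G) := \frac{2}{n^2}\sum_{e \in E(G)} w_T(e)$. The Turán graph $T(n,k)$ is the complete balanced $k$-partite graph on $n$ vertices. The edit distance between two graphs on the same $n$-vertex set is the number of pairs that are edges in exactly one of them. *)

(* Defs.v *)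
From mathcomp Require Import all_boot all_order all_algebra.
From mathcomp Require Import reals.
Set Implicit Arguments.
Unset Strict Implicit.
Unset Printing Implicit Defensive.
Import Order.TTheory GRing.Theory Num.Theory.
Local Open Scope ring_scope.

Record sgraph (T : finType) := SGraph {
  adj :> rel T;
  adj_sym : symmetric adj;
  adj_irr : irreflexive adj
}.

Definition edges (T : finType) (G : sgraph T) : {set {set T}} :=
  [set [set p.1; p.2] | p in [pred p : T * T | G p.1 p.2]].

Definition clique (T : finType) (G : sgraph T) (S : {set T}) : bool :=
  [forall x in S, forall y in S, (x != y) ==> G x y].

(* r(e); the edge e is itself a clique, so the maximum is at least 2 when
   e \in edges G. *)
Definition clique_order (T : finType) (G : sgraph T) (e : {set T}) : nat :=
  \max_(S : {set T} | clique G S && (e \subset S)) #|S|.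

Definition turan_weight (R : realType) (r : nat) : R :=
  r%:R / (2 * (r%:R - 1)).

Definition turan_graph_weight (R : realType) (T : finType) (G : sgraph T) : R :=
  2 / #|T|%:R ^+ 2 * \sum_(e in edges G) turan_weight R (clique_order G e).

(* H is a copy of T(#|T|, k) on the vertex set T: p x is the part of x.  When
   #|T| < k some parts are empty and H is complete. *)
Definition is_turan_graph (T : finType) (k : nat) (H : sgraph T) : Prop :=
  exists p : T -> 'I_k,
    (forall i j : 'I_k, (#|[set x | p x == i]| <= #|[set x | p x == j]|.+1)%N)
    /\ (forall x y : T, H x y = (p x != p y)).

Definition edit_distance (T : finType) (G H : sgraph T) : nat :=
  #|[set e : {set T} | (e \in edges G) (+) (e \in edges H)]|.

(* Main.v *)
Require Import Defs.
From mathcomp Require Import all_boot all_order all_algebra.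
From mathcomp Require Import perm reals.
From mathcomp Require Import lra ring.
Set Implicit Arguments.
Unset Strict Implicit.
Unset Printing Implicit Defensive.
Import Order.TTheory GRing.Theory Num.Theory.
Local Open Scope ring_scope.

(** Put A(u,v) = r/(r-1) on each edge uv, where r = r(uv), and A(u,v) = 0 on
    non-edges.  For a probability vector x, the form f(x) = x^T A x is at most
    1: collapsing the mass of all non-neighbours of v onto v, for v of maximal
    weighted degree, never decreases f, gains the weight inside the collapsed
    set, and after finitely many rounds leaves x supported on a clique of size
    s, where f(x) <= 1 - sum_c (x_c - 1/s)^2.

    For stability take x uniform with f(x) >= 1 - lam^4, and choose the first
    vertex v to maximise degree + lam * (mass of non-neighbours).  The first
    collapse then loses at most 2 lam, so the collapsed classes span few edges
    and have nearly equal sizes, close to 1/s.  As f <= 1 also bounds every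
    degree from above, v has nearly at least the average number of
    non-neighbours, so the non-edge density is at most about 1/s.  The classes already
    account for that many non-edges, hence almost no non-edges run between
    them.  Finally the classes are made exactly balanced, or, when s is large,
    G is compared with the complete graph. *)

Lemma cliqueP (T : finType) (G : sgraph T) (S : {set T}) :
  reflect {in S &, forall x y, x != y -> G x y} (clique G S).
Proof.
apply: (iffP forall_inP) => [h x y xS yS|h x xS].
  by have /forall_inP/(_ y yS)/implyP := h x xS.
by apply/forall_inP => y yS; apply/implyP; apply: h.
Qed.

(** * Edge weights as a symmetric matrix *)

Section EdgeWeight.
Variables (R : realType) (T : finType) (G : sgraph T).

Definition edge_weight (u v : T) : R :=
  if G u v then 2 * turan_weight R (clique_order G [set u; v]) else 0.

Lemma clique_order_ge (S : {set T}) u v :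
  clique G S -> u \in S -> v \in S -> (#|S| <= clique_order G [set u; v])%N.
Proof.
move=> cS uS vS; apply: (@leq_bigmax_cond _ _ (fun S : {set T} => #|S|)).
by rewrite cS subUset !sub1set uS vS.
Qed.

Lemma clique_order_edge u v : G u v -> (2 <= clique_order G [set u; v])%N.
Proof.
move=> Guv; have neq_uv : u != v by apply: contraTneq Guv => ->; rewrite adj_irr.
have <- : #|[set u; v]| = 2%N by rewrite cards2 neq_uv.
apply: clique_order_ge; rewrite ?set21 ?set22 //.
apply/cliqueP => x y /set2P[]-> /set2P[]->; rewrite ?eqxx //.
by rewrite adj_sym.
Qed.

Lemma edge_weightC u v : edge_weight u v = edge_weight v u.
Proof. by rewrite /edge_weight adj_sym setUC. Qed.

Lemma edge_weight_nadj u v : ~~ G u v -> edge_weight u v = 0.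
Proof. by rewrite /edge_weight => /negbTE ->. Qed.

Lemma edge_weightE u v : G u v ->
  edge_weight u v = 1 + ((clique_order G [set u; v])%:R - 1)^-1.
Proof.
move=> Guv; rewrite /edge_weight Guv /turan_weight.
have : 2 <= (clique_order G [set u; v])%:R :> R.
  by rewrite ler_nat clique_order_edge.
move: (clique_order _ _)%:R => r r2; field.
by rewrite subr_eq0 gt_eqF //; lra.
Qed.

Lemma edge_weight_ge1 u v : G u v -> 1 <= edge_weight u v.
Proof.
move=> Guv; rewrite edge_weightE // lerDl invr_ge0 subr_ge0.
by rewrite (ler_nat R 1) ltnW // clique_order_edge.
Qed.

Lemma edge_weight_ge0 u v : 0 <= edge_weight u v.
Proof.
have [/edge_weight_ge1 | /edge_weight_nadj -> //] := boolP (G u v).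
exact: le_trans.
Qed.

(** [#|S|] is at most r(uv), and r/(r-1) decreases in r. Multiplying out by [#|S| - 1] avoids an
    inverse. *)
Lemma edge_weight_clique (S : {set T}) u v :
    clique G S -> u \in S -> v \in S -> u != v ->
  edge_weight u v * (#|S|%:R - 1) <= #|S|%:R.
Proof.
move=> cS uS vS neq_uv; have Guv := elimT (cliqueP _ _) cS u v uS vS neq_uv.
rewrite edge_weightE //.
have : #|S|%:R <= (clique_order G [set u; v])%:R :> R.
  by rewrite ler_nat clique_order_ge.
have : 2 <= (clique_order G [set u; v])%:R :> R.
  by rewrite ler_nat clique_order_edge.
move: (#|S|%:R) (clique_order _ _)%:R => s r r2 sr.
have : (r - 1)^-1 * (s - 1) <= 1 by rewrite mulrC ler_pdivrMr; lra.
by rewrite mulrDl mul1r; lra.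
Qed.

(** An edge is the image of exactly two ordered pairs. *)
Lemma sum_edges (F : {set T} -> R) :
  2 * \sum_(e in edges G) F e = \sum_u \sum_(v | G u v) F [set u; v].
Proof.
rewrite pair_big_dep /= (partition_big (fun p => [set p.1; p.2]) (mem (edges G))) /=;
  last by move=> p Gp; apply/imsetP; exists p.
rewrite mulr_sumr; apply: eq_bigr => _ /imsetP[[a b] /= Gab ->].
rewrite inE /= in Gab.
have neq_ab : a != b by apply: contraTneq Gab => ->; rewrite adj_irr.
rewrite (eq_bigr (fun=> F [set a; b])) => [|p /andP[_ /eqP->] //].
rewrite sumr_const -[RHS]mulr_natl; congr (_ * _).
congr (_%:R); have <- : #|[set (a, b); (b, a)]| = 2%N.
  by rewrite cards2 xpair_eqE negb_and neq_ab.
apply: eq_card => -[x y]; rewrite !inE !xpair_eqE /=.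
apply/orP/andP => [[]/andP[/eqP-> /eqP->]|[Gxy /eqP exy]].
- by rewrite Gab eqxx.
- by rewrite adj_sym Gab setUC eqxx.
have neq_xy : x != y by apply: contraTneq Gxy => ->; rewrite adj_irr.
have : x \in [set a; b] by rewrite -exy set21.
have : y \in [set a; b] by rewrite -exy set22.
by move=> /set2P[]ey /set2P[]ex; move: neq_xy; rewrite ex ey !eqxx; auto.
Qed.

Lemma turan_graph_weightE :
  2 * turan_graph_weight R G =
    \sum_u \sum_v #|T|%:R^-1 * #|T|%:R^-1 * edge_weight u v.
Proof.
rewrite /turan_graph_weight.
transitivity (#|T|%:R^-1 ^+ 2 * 2 *
   (2 * \sum_(e in edges G) turan_weight R (clique_order G e))).
  by rewrite exprVn; ring.
rewrite sum_edges mulr_sumr; apply: eq_bigr => u _.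
rewrite -mulr_sumr -mulrA -expr2; congr (_ * _).
rewrite mulr_sumr big_mkcond /=; apply: eq_bigr => v _.
by rewrite /edge_weight; case: ifP.
Qed.

End EdgeWeight.

(** * Collapsing sets of non-neighbours *)

Section Symmetrization.
Variables (R : realType) (T : finType) (G : sgraph T).
Implicit Types (x : T -> R) (p q : T -> T) (P W : {set T}).
Local Notation A := (edge_weight R G).

(** The quadratic form at the image of [x] under [p]: the mass [x u] sits at [p u]. Keeping [x]
    fixed and changing only [p] lets the collapsed classes be read off as fibres of the final
    map. *)
Definition pushed_weight x p : R :=
  \sum_u \sum_v x u * x v * A (p u) (p v).

Definition pushed_degree x p u : R := \sum_v x v * A u (p v).

(** The original weight between vertices that end at the same place: this is what the successive
    collapses gain. *)
Definition fibre_weight x p W : R :=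
  \sum_(u in W) \sum_(v in W | p v == p u) x u * x v * A u v.

Lemma pushed_weight_split x p P :
  pushed_weight x p =
    \sum_(u in P) \sum_(v in P) x u * x v * A (p u) (p v) +
    2 * (\sum_(u in P) \sum_(v | v \notin P) x u * x v * A (p u) (p v)) +
    \sum_(u | u \notin P) \sum_(v | v \notin P) x u * x v * A (p u) (p v).
Proof.
rewrite /pushed_weight (bigID (mem P)) /=.
under eq_bigr do rewrite (bigID (mem P)) /=.
under [X in _ + X]eq_bigr do rewrite (bigID (mem P)) /=.
rewrite !big_split /=.
set B := \sum_(u in P) \sum_(v | v \notin P) _.
have -> : \sum_(u | u \notin P) \sum_(v in P) x u * x v * A (p u) (p v) = B.
  rewrite exchange_big /=; apply: eq_bigr => u _; apply: eq_bigr => v _.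
  by rewrite edge_weightC [x v * _]mulrC.
by ring.
Qed.

(** The block on [P] is lost, and the cross block, counted twice, trades each row [u] for the row of
    [v]. Twice the difference of degrees charges the block on [P] twice instead of once, whence the
    last term. *)
Lemma pushed_weight_collapse x p v P :
    v \in P -> {in P, p =1 id} -> {in P, forall u, ~~ G v u} ->
  pushed_weight x (fun u => if u \in P then v else p u) =
    pushed_weight x p
    + 2 * (\sum_(u in P) x u * (pushed_degree x p v - pushed_degree x p u))
    + \sum_(u in P) \sum_(w in P) x u * x w * A u w.
Proof.
move=> vP pP nvP; rewrite !(pushed_weight_split _ _ P).
have A0 u : u \in P -> A v u = 0 by move=> uP; rewrite edge_weight_nadj ?nvP.
rewrite [X in X + _ + _]big1 => [|u uP]; last first.
  by apply: big1 => w wP; rewrite uP wP A0 ?mulr0.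
rewrite add0r; under eq_bigr => u uP do under eq_bigr => w /negbTE wP do rewrite uP wP.
under [X in _ + X = _]eq_bigr => u /negbTE uP do
  under eq_bigr => w /negbTE wP do rewrite uP wP.
set B3 := \sum_(u | u \notin P) _.
have -> : \sum_(u in P) \sum_(w in P) x u * x w * A (p u) (p w) =
          \sum_(u in P) \sum_(w in P) x u * x w * A u w.
  by apply: eq_bigr => u uP; apply: eq_bigr => w wP; rewrite !pP.
have -> : \sum_(u in P) \sum_(w | w \notin P) x u * x w * A (p u) (p w) =
          \sum_(u in P) \sum_(w | w \notin P) x u * x w * A u (p w).
  by apply: eq_bigr => u uP; apply: eq_bigr => w wP; rewrite (pP u uP).
set B2 := \sum_(u in P) \sum_(w in P) _.
set B1 := \sum_(u in P) \sum_(w | w \notin P) x u * x w * A u _.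
set B0 := \sum_(u in P) _.
have -> : \sum_(u in P) x u * (pushed_degree x p v - pushed_degree x p u) =
          B0 - (B2 + B1).
  rewrite /B0 /B1 /B2 -big_split -sumrB; apply: eq_bigr => u uP /=.
  rewrite mulrBr; congr (_ - _).
    rewrite /pushed_degree (bigID (mem P)) /= big1 => [|w wP].
      by rewrite add0r mulr_sumr; apply: eq_bigr => w _; rewrite mulrA.
    by rewrite pP // A0 // mulr0.
  rewrite /pushed_degree (bigID (mem P)) /= mulrDr !mulr_sumr.
  congr (_ + _); apply: eq_bigr => w wP; first by rewrite pP // mulrA.
  by rewrite mulrA.
by ring.
Qed.

(** The fibre over [v] meets [W] exactly in [P], so no fibre is split. *)
Lemma fibre_weightD x q W P v :
    P \subset W -> {in P, forall u, q u = v} -> {in W :\: P, forall u, q u != v} ->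
  fibre_weight x q W =
    \sum_(u in P) \sum_(w in P) x u * x w * A u w + fibre_weight x q (W :\: P).
Proof.
move=> /subsetP sPW qP qW; rewrite /fibre_weight (bigID (mem P)) /=; congr (_ + _).
  apply: eq_big => [u|u /andP[_ uP]].
    by rewrite andbC; case: (boolP (u \in P)) => // /sPW.
  apply: eq_bigl => w; rewrite (qP u) //.
  have [wP|wP] := boolP (w \in P); first by rewrite sPW // qP ?eqxx.
  by apply/negP => /andP[wW]; apply/negP/qW; rewrite inE wP.
apply: eq_big => [u|u /andP[uW uP]]; first by rewrite inE andbC.
apply: eq_bigl => w; rewrite inE.
have [wP|//] := boolP (w \in P); rewrite qP //= eq_sym.
by apply/negP => /andP[_]; apply/negP/qW; rewrite inE uP.
Qed.

(** [W] holds the vertices not yet processed: [p] fixes them, and the images of the others form a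
    clique completely joined to [W]. A round picks [v] in [W] of largest pushed degree and sends its
    non-neighbours in [W] to [v]; the rest of [W] is adjacent to [v], so the invariant survives with
    a smaller [W]. *)
Lemma symmetrize x p W :
    (forall u, 0 <= x u) -> {in W, p =1 id} ->
    (forall u w, u \notin W -> w \in W -> G (p u) w) -> clique G (p @: ~: W) ->
  exists q, [/\ clique G (q @: [set: T]), {in ~: W, q =1 p},
    {in W, forall u, q u \in W} &
    pushed_weight x p + fibre_weight x q W <= pushed_weight x q].
Proof.
move=> x_ge0; move: {2}(#|W|.+1) (ltnSn #|W|) => m.
elim: m p W => // m IHm p W ltWm pW adjW clK.
have [W0|[v0 v0W]] := set_0Vmem W.
  exists p; split => //; first by rewrite -setC0 -W0.
    by move=> u; rewrite W0 inE.
  by rewrite /fibre_weight W0 big_set0 addr0.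
pose v := [arg max_(u > v0 in W) pushed_degree x p u]%O.
have [vW v_max] : v \in W /\ {in W, forall u, pushed_degree x p u <= pushed_degree x p v}.
  by rewrite /v; case: arg_maxP.
pose P := [set u in W | ~~ G v u].
pose p' u := if u \in P then v else p u.
have vP : v \in P by rewrite inE vW adj_irr.
have sPW : P \subset W by apply/subsetP => u /[!inE] /andP[].
have ltW' : (#|W :\: P| < m)%N.
  rewrite -ltnS; apply: leq_trans ltWm; rewrite ltnS; apply: proper_card.
  rewrite properEneq subsetDl andbT; apply: contraTneq vP => eW.
  by move: vW; rewrite -eW inE => /andP[].
case: (IHm p' (W :\: P)) => //.
- by move=> u /[!inE] /andP[uP uW]; rewrite /p' !inE (negbTE uP) pW.
- move=> u w; rewrite /p' !inE.
  have [uW|uW] := boolP (u \in W) => /=; last by move=> _ /andP[_]; apply: adjW.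
  by case: ifP => //= _ _ /andP[] /[swap] -> /=; rewrite negbK.
- apply/cliqueP => _ _ /imsetP[u uW ->] /imsetP[w wW ->]; rewrite /p'.
  have nPW z : z \in ~: (W :\: P) -> z \notin P -> z \notin W.
    by rewrite !inE => /[swap] -> /=.
  have [uP|uP] := boolP (u \in P); have [wP|wP] := boolP (w \in P).
  + by rewrite eqxx.
  + by move=> _; rewrite adj_sym adjW ?nPW.
  + by move=> _; rewrite adjW ?nPW.
  by apply: (elimT (cliqueP _ _) clK); rewrite imset_f // inE nPW.
move=> q [clq qp' qW' le_q].
have qP u : u \in P -> q u = v.
  by move=> uP; rewrite qp' ?in_setC ?in_setD ?uP // /p' uP.
have qW u : u \in W :\: P -> q u != v.
  by move=> /qW'; apply: contraTneq => ->; rewrite inE vP.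
exists q; split => //.
- move=> u /[!inE] uW; rewrite qp' /p' ?inE ?(negbTE uW) ?andbF //.
- move=> u uW; have [uP|uP] := boolP (u \in P); first by rewrite qP.
  by have := qW' u; rewrite in_setD uP uW => /(_ isT) /setDP[].
apply: le_trans le_q; rewrite (fibre_weightD _ sPW qP qW) addrA lerD2r.
rewrite /p' pushed_weight_collapse // ?lerD2r ?lerDl.
- rewrite mulr_ge0 //; apply: sumr_ge0 => u uP.
  by rewrite mulr_ge0 ?subr_ge0 ?v_max // (subsetP sPW).
- by move=> u /(subsetP sPW); apply: pW.
by move=> u /[!inE] /andP[].
Qed.

End Symmetrization.

(** * The bound f(x) <= 1 for probability vectors *)

Section WeightedBound.
Variables (R : realType) (T : finType) (G : sgraph T).
Variable x : T -> R.
Hypotheses (x_ge0 : forall u, 0 <= x u) (x_sum1 : \sum_u x u = 1).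
Local Notation A := (edge_weight R G).

Definition fibre_mass (p : T -> T) (c : T) : R := \sum_(u | p u == c) x u.

(** The sum includes [u] itself, so that averages of it count the diagonal, as do the squared class
    masses with which they are compared. *)
Definition nonnbr_mass (u : T) : R := \sum_(v | ~~ G u v) x v.

Lemma sum_le1 (P : pred T) : \sum_(u | P u) x u <= 1.
Proof.
rewrite -x_sum1 [X in _ <= X](bigID P) /= lerDl.
exact: sumr_ge0.
Qed.

Lemma vertex_exists : exists v : T, True.
Proof.
have [v _|T0] := pickP (@predT T); first by exists v.
by move: x_sum1; rewrite big1 => [/esym/eqP|u]; [rewrite oner_eq0 | have := T0 u].
Qed.

Lemma fibre_weight_ge0 p W : 0 <= fibre_weight G x p W.
Proof.
apply: sumr_ge0 => u _; apply: sumr_ge0 => v _.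
by rewrite !mulr_ge0 ?edge_weight_ge0.
Qed.

Lemma sum_fibre_mass p : \sum_(c in p @: [set: T]) fibre_mass p c = 1.
Proof.
rewrite -x_sum1 [RHS](partition_big p (mem (p @: [set: T]))) //=.
by move=> u _; rewrite imset_f ?inE.
Qed.

Lemma sum_fibre_mass_sqr p :
  \sum_(c in p @: [set: T]) fibre_mass p c ^+ 2 =
  \sum_u \sum_(v | p v == p u) x u * x v.
Proof.
rewrite [RHS](partition_big p (mem (p @: [set: T]))) /=; last first.
  by move=> u _; rewrite imset_f ?inE.
apply: eq_bigr => c _; rewrite expr2 {1}/fibre_mass mulr_suml.
by apply: eq_bigr => u /eqP ->; rewrite mulr_sumr.
Qed.

Lemma sum_fibre_mass_var p (s := #|p @: [set: T]|%:R : R) :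
  \sum_(c in p @: [set: T]) (fibre_mass p c - s^-1) ^+ 2 =
  \sum_(c in p @: [set: T]) fibre_mass p c ^+ 2 - s^-1.
Proof.
have s_neq0 : s != 0.
  have [v _] := vertex_exists; rewrite pnatr_eq0 -lt0n card_gt0.
  by apply/set0Pn; exists (p v); rewrite imset_f.
under eq_bigr do rewrite sqrrB.
rewrite big_split sumrB /= sumr_const -[s^-1 ^+ 2 *+ _]mulr_natl -/s.
rewrite sumrMnl -mulr_suml sum_fibre_mass -addrA; congr (_ + _).
by rewrite expr2 mulrA mulfV //; ring.
Qed.

(* Motzkin-Straus on a clique, with the variance of the vertex masses as deficit. *)
Lemma pushed_weight_clique p (s := #|p @: [set: T]|%:R : R) :
    clique G (p @: [set: T]) ->
  pushed_weight G x p +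
    \sum_(c in p @: [set: T]) (fibre_mass p c - s^-1) ^+ 2 <= 1.
Proof.
move=> clC; have [v0 _] := vertex_exists.
have s_gt0 : (0 < #|p @: [set: T]|)%N.
  by rewrite card_gt0; apply/set0Pn; exists (p v0); rewrite imset_f.
have var_ge0 : 0 <= \sum_(c in p @: [set: T]) (fibre_mass p c - s^-1) ^+ 2.
  by apply: sumr_ge0 => c _; rewrite sqr_ge0.
(* A pair in different fibres has weight at most s/(s-1), a pair in one fibre weight 0; the 1 is
   expanded as the square of the total mass. *)
have le_w : (s - 1) * pushed_weight G x p <=
    s * (1 - \sum_(c in p @: [set: T]) fibre_mass p c ^+ 2).
  have {2}-> : 1 = \sum_u \sum_v x u * x v.
    by under eq_bigr do rewrite -mulr_sumr x_sum1 mulr1.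
  rewrite sum_fibre_mass_sqr -sumrB !mulr_sumr; apply: ler_sum => u _.
  rewrite [X in s * (X - _)](bigID (fun v => p v == p u)) /= [X in s * (X - _)]addrC addrK.
  rewrite (bigID (fun v => p v == p u)) /= mulrDr big1 => [|v /eqP->].
    rewrite mulr0 add0r !mulr_sumr; apply: ler_sum => v neq_uv.
    have := @edge_weight_clique R T G _ (p u) (p v) clC.
    rewrite !imset_f ?inE // eq_sym => /(_ isT isT neq_uv) => le_s.
    rewrite mulrCA [s * _]mulrC; apply: ler_wpM2l; first exact: mulr_ge0.
    by rewrite mulrC.
  by rewrite edge_weight_nadj ?mulr0 ?adj_irr.
(* The bound [le_w] is void for s = 1; there the weight is 0 and the single class has mass 1, so the
   deficit is 0. *)
have [s1|s_neq1] := eqVneq #|p @: [set: T]| 1%N.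
  have [c C1] := cards1P (introT eqP s1).
  have p1 u : p u = c by apply/set1P; rewrite -C1 imset_f.
  have -> : pushed_weight G x p = 0.
    apply: big1 => u _; apply: big1 => v _.
    by rewrite !p1 edge_weight_nadj ?mulr0 ?adj_irr.
  rewrite add0r /s C1 cards1 big_set1 invr1 /fibre_mass.
  rewrite (eq_bigl predT) ?x_sum1 ?subrr ?expr0n //.
  by move=> u; rewrite p1 eqxx.
have s_ge2 : 2 <= s by rewrite ler_nat ltn_neqAle eq_sym s_neq1.
have : s * s^-1 = 1 by rewrite mulfV // gt_eqF // ltr0n.
move: var_ge0 le_w; rewrite sum_fibre_mass_var -/s.
move: (pushed_weight _ _ _) (\sum_(_ in _) _) (s^-1) => F S2 i.
move=> V_ge0 le_F s_i.
(* With V = S2 - 1/s, [le_w] gives (s-1)(F + V) <= s - 1 - V, and V >= 0. *)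
rewrite -(ler_pM2l (_ : 0 < s - 1)); last by lra.
have -> : (s - 1) * (F + (S2 - i)) = (s - 1) * F + s * S2 - s * i - (S2 - i) by ring.
by move: le_F; rewrite mulrBr; lra.
Qed.

Lemma pushed_weight_le1 : pushed_weight G x id <= 1.
Proof.
case: (@symmetrize R T G x id [set: T]) => //; first by move=> u w; rewrite inE.
  by rewrite setCT imset0; apply/cliqueP => u w; rewrite inE.
move=> q [clq _ _ le_q]; have := pushed_weight_clique clq.
have := fibre_weight_ge0 q [set: T].
have : 0 <= \sum_(c in q @: [set: T])
    (fibre_mass q c - #|q @: [set: T]|%:R^-1) ^+ 2.
  by apply: sumr_ge0 => c _; rewrite sqr_ge0.
by lra.
Qed.

Lemma pushed_weight_idE :
  pushed_weight G x id = \sum_u x u * pushed_degree G x id u.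
Proof.
apply: eq_bigr => u _; rewrite mulr_sumr; apply: eq_bigr => v _.
by rewrite mulrA.
Qed.

End WeightedBound.

(** * Stability for the weighted form *)

Section WeightedStability.
Variables (R : realType) (T : finType) (G : sgraph T).
Variable x : T -> R.
Hypotheses (x_ge0 : forall u, 0 <= x u) (x_sum1 : \sum_u x u = 1).
Local Notation A := (edge_weight R G).

(* Compare [x] with [(1 - t) x + t e_v], whose weight is also at most 1. *)
Lemma pushed_degree_le v t :
    0 < t <= 2^-1 -> 1 - t ^+ 2 <= pushed_weight G x id ->
  pushed_degree G x id v <= 1 + 2 * t.
Proof.
move=> /andP[t_gt0 t_le] le_f.
pose y u := (1 - t) * x u + t * (u == v)%:R.
have sum_delta (F : T -> R) : \sum_u (u == v)%:R * F u = F v.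
  rewrite (bigD1 v) //= eqxx mul1r big1 ?addr0 // => u /negbTE->.
  exact: mul0r.
have y_ge0 u : 0 <= y u by rewrite addr_ge0 ?mulr_ge0 //; lra.
have y_sum1 : \sum_u y u = 1.
  rewrite big_split /= -!mulr_sumr x_sum1.
  have := sum_delta (fun=> 1); under eq_bigr do rewrite mulr1.
  by move=> ->; ring.
have deg_y u : pushed_degree G y id u =
    (1 - t) * pushed_degree G x id u + t * A u v.
  rewrite -(sum_delta (A u)) /pushed_degree !mulr_sumr -big_split /=.
  by apply: eq_bigr => w _; rewrite /y; ring.
have := pushed_weight_le1 G y_ge0 y_sum1; rewrite pushed_weight_idE.
under eq_bigr => u _ do rewrite /y mulrDl -!mulrA deg_y.
rewrite big_split /= -!mulr_sumr sum_delta edge_weight_nadj ?adj_irr //.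
under eq_bigr => u _ do rewrite mulrDr mulrCA [x u * (t * _)]mulrCA.
rewrite big_split /= -!mulr_sumr -pushed_weight_idE.
have -> : \sum_u x u * A u v = pushed_degree G x id v.
  by apply: eq_bigr => u _; rewrite edge_weightC.
move: le_f; move: (pushed_weight _ _ _) (pushed_degree _ _ _ _) => f D.
(* The weight of [y] is (1-t)^2 f + 2t(1-t) D, and f >= 1 - t^2; what remains is 2t^2 - 2t^3 - t^4
   >= 0. *)
move=> le_f le1; rewrite -(ler_pM2l (_ : 0 < 2 * t * (1 - t))); last first.
  by rewrite !mulr_gt0 //; lra.
have : (1 - t) ^+ 2 * (1 - t ^+ 2) <= (1 - t) ^+ 2 * f.
  by rewrite ler_wpM2l // sqr_ge0.
have : 0 <= t ^+ 2 * (2^-1 - t) by rewrite mulr_ge0 ?sqr_ge0 //; lra.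
have : 0 <= t ^+ 3 * (2^-1 - t) by rewrite mulr_ge0 ?exprn_ge0 //; lra.
have : 0 <= t ^+ 3  by rewrite exprn_ge0 //; lra.
have : 0 <= t ^+ 4  by rewrite exprn_ge0 //; lra.
by move: le1; rewrite -subr_ge0 => le1; nra.
Qed.

Lemma weighted_stability lam :
    0 < lam <= 2^-1 -> 1 - lam ^+ 4 <= pushed_weight G x id ->
  exists q v, [/\ fibre_weight G x q [set: T] +
       \sum_(c in q @: [set: T]) (fibre_mass x q c - #|q @: [set: T]|%:R^-1) ^+ 2
         <= 3 * lam,
     v \in q @: [set: T] &
     \sum_u x u * nonnbr_mass G x u <= fibre_mass x q v + 3 * lam].
Proof.
move=> /andP[lam_gt0 lam_le] le_f.
have [v0 _] := vertex_exists x_sum1.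
pose score u := pushed_degree G x id u + lam * nonnbr_mass G x u.
pose v := [arg max_(u > v0) score u]%O.
have v_max u : score u <= score v by rewrite /v; case: arg_maxP => // w _; apply.
have m_ge0 u : 0 <= nonnbr_mass G x u by exact: sumr_ge0.
have m_le1 u : nonnbr_mass G x u <= 1 by exact: sum_le1.
have deg_v u : - lam <= pushed_degree G x id v - pushed_degree G x id u.
  have := v_max u; rewrite /score.
  have := ler_wpM2l (ltW lam_gt0) (m_le1 v).
  by have := mulr_ge0 (ltW lam_gt0) (m_ge0 u); lra.
pose P := [set u | ~~ G v u].
have vP : v \in P by rewrite inE adj_irr.
(* The first collapse is done by hand, as [v] maximises [score] and not the degree. Its image [v] is
   a one-point clique joined to [~: P], so [symmetrize] can do the remaining rounds. *)
case: (@symmetrize R T G x (fun u => if u \in P then v else u) (~: P)) => //.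
- by move=> u /[!inE] /negbTE ->.
- by move=> u w; rewrite !inE !negbK => ->.
- apply/cliqueP => _ _ /imsetP[u + ->] /imsetP[w + ->].
  by rewrite setCK => -> ->; rewrite eqxx.
move=> q [clq qP qW le_q]; exists q, v.
have qPv u : u \in P -> q u = v by move=> uP; rewrite qP ?setCK // uP.
have qWv u : u \in [set: T] :\: P -> q u != v.
  by rewrite setTD => /qW; apply: contraTneq => ->; rewrite inE vP.
split.
- rewrite (fibre_weightD _ _ (subsetT P) qPv qWv) setTD.
  have := pushed_weight_clique x_ge0 x_sum1 clq.
  move: le_q; rewrite (@pushed_weight_collapse _ _ _ _ id) //; last first.
    by move=> u /[!inE].
  (* By [deg_v] the degree terms lose at most 2 lam in all; with the lam^4 missing from f this makes
     the 3 lam of the bound. *)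
  have : - lam <= \sum_(u in P) x u * (pushed_degree G x id v - pushed_degree G x id u).
    apply: (@le_trans _ _ (\sum_(u in P) x u * - lam)).
      rewrite -mulr_suml mulrN lerN2 -[leRHS]mul1r.
      by rewrite ler_wpM2r ?(ltW lam_gt0) ?sum_le1.
    by apply: ler_sum => u _; rewrite ler_wpM2l.
  have : lam ^+ 4 <= lam.
    by rewrite -[leRHS]expr1 ler_wiXn2l //; lra.
  by lra.
- by apply/imsetP; exists v; rewrite ?qPv.
(* Later collapses keep [~: P] inside itself, so the fibre over [v] stays exactly [P]. *)
have -> : fibre_mass x q v = nonnbr_mass G x v.
  apply: eq_bigl => u; have [uP|uP] := boolP (u \in P).
    by rewrite qPv // eqxx; move: uP; rewrite inE => ->.
  have := uP; rewrite inE => /negbTE->; apply/negbTE/qWv.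
  by rewrite setTD inE.
(* The degree bound is used with t = lam^2, hence the exponent 4 in the hypothesis; once divided by
   lam, the errors 2 lam^2 and lam^4 cost at most 3 lam. *)
have le_deg : pushed_degree G x id v <= 1 + 2 * lam ^+ 2.
  apply: pushed_degree_le; last by rewrite -exprM.
  by rewrite exprn_gt0 //=; nra.
have : \sum_u x u * score u <= score v.
  rewrite -[leRHS]mul1r -x_sum1 mulr_suml.
  by apply: ler_sum => u _; rewrite ler_wpM2l.
under eq_bigr do rewrite /score mulrDr mulrCA.
rewrite big_split /= -pushed_weight_idE -mulr_sumr /score.
move=> le_M; rewrite -(ler_pM2l lam_gt0) mulrDr [lam * (3 * _)]mulrCA -expr2.
have : lam ^+ 4 <= lam ^+ 2 by rewrite ler_wiXn2l //; lra.
by lra.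
Qed.

End WeightedStability.

(** * Balanced colourings *)

Section Balancing.
Variables (T : finType) (k : nat).
Hypothesis k_gt0 : (0 < k)%N.
Local Open Scope nat_scope.

Definition balanced (b : T -> 'I_k) :=
  [forall i, forall j, #|[set x | b x == i]| <= #|[set x | b x == j]|.+1].

Lemma balancedP b :
  reflect (forall i j, #|[set x | b x == i]| <= #|[set x | b x == j]|.+1)
          (balanced b).
Proof. by apply: (iffP 'forall_forallP). Qed.

(** Greedy: each new vertex joins a smallest class. Counting along [enum T] turns this into an
    induction on lists. *)
Lemma balanced_exists : exists b : {ffun T -> 'I_k}, balanced b.
Proof.
suff [b bT] : exists b : T -> 'I_k, forall i j,
    count [pred x | b x == i] (enum T) <= (count [pred x | b x == j] (enum T)).+1.
  exists (finfun b); apply/balancedP => i j.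
  have eb l : #|[set x | [ffun x => b x] x == l]| = count [pred x | b x == l] (enum T).
    rewrite cardE -size_filter /enum_mem; congr size.
    rewrite -filter_predI; apply: eq_filter => x.
    by rewrite /= !inE ffunE andbT.
  by rewrite !eb.
elim: (enum T) (enum_uniq T) => [_|x r IHr /= /andP[x_r /IHr[b br]]].
  by exists (fun=> Ordinal k_gt0).
pose N i := count [pred y | b y == i] r.
pose j0 := [arg min_(j < Ordinal k_gt0) N j].
have j0_min j : N j0 <= N j by rewrite /j0; case: arg_minnP => // l _; apply.
exists (fun y => if y == x then j0 else b y) => i j.
have N' l : count [pred y | (if y == x then j0 else b y) == l] r = N l.
  by apply: eq_in_count => y yr /=; rewrite ifN //; apply: contraNneq x_r => <-.
rewrite !N' eqxx; have [<-|_] := eqVneq j0 i.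
  by rewrite add1n ltnS (leq_trans (j0_min j)) ?leq_addl.
by rewrite add0n (leq_trans (br i j)) // ltnS leq_addl.
Qed.

(* A balanced colouring agreeing with [p] as often as possible: if some class
   of [p] and some class of [b] of the same colour were not nested, swapping
   two vertices would increase the agreement. *)
Lemma rebalance (p : T -> 'I_k) : exists2 b : T -> 'I_k, balanced b &
  forall c, #|[set x | (p x == c) && (b x != c)]| <=
            #|[set x | p x == c]| - #|[set x | b x == c]|.
Proof.
have [b0 b0_bal] := balanced_exists.
pose b := [arg max_(f > b0 | balanced f) #|[set x | f x == p x]|].
have [b_bal b_max] : balanced b /\ forall f : {ffun T -> 'I_k}, balanced f ->
    #|[set x | f x == p x]| <= #|[set x | b x == p x]|.
  by rewrite /b; case: arg_maxnP.
exists b => // c.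
have [u /andP[/eqP pu bu]|no_u] := pickP [pred x | (p x == c) && (b x != c)]; last first.
  by rewrite (_ : [set _ | _] = set0) ?cards0 //; apply/setP => x; rewrite !inE -(no_u x).
(* Without such a [w] the class of [b] lies inside that of [p], and the subtraction is not
   truncated. *)
have [w /andP[/eqP bw pw]|no_w] := pickP [pred x | (b x == c) && (p x != c)]; last first.
  rewrite -cardsDS.
    by apply/subset_leq_card/subsetP => x; rewrite !inE andbC.
  apply/subsetP => x; rewrite !inE => bx; have := no_w x.
  by rewrite /= bx => /negbFE.
(* [u] now gets its colour under [p]; as neither [u] nor [w] agreed with [p] before, no agreement is
   lost. *)
pose f := [ffun x => b (tperm u w x)].
have f_bal : balanced f.
  have card_f i : #|[set x | f x == i]| = #|[set x | b x == i]|.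
    rewrite -(card_imset _ (@perm_inj _ (tperm u w))); apply: eq_card => x.
    apply/imsetP/idP => [[y + ->]|].
      by rewrite !inE ffunE.
    by rewrite inE => bx; exists (tperm u w x); rewrite ?tpermK // inE ffunE tpermK.
  by apply/balancedP => i j; rewrite !card_f; apply/balancedP.
have := b_max f f_bal; rewrite leqNgt => /negP[]; apply: proper_card.
apply/properP; split; last first.
  by exists u; rewrite !inE ?ffunE ?tpermL ?pu ?bw.
apply/subsetP => x; rewrite !inE ffunE => bx; rewrite tpermD //.
  by apply: contraTneq bx => <-; rewrite pu.
by apply: contraTneq bx => <-; rewrite bw eq_sym.
Qed.

Lemma balanced_card (b : T -> 'I_k) c :
  balanced b -> #|T| <= k * #|[set x | b x == c]|.+1.
Proof.
move=> /balancedP b_bal.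
have -> : k * #|[set x | b x == c]|.+1 = \sum_(i < k) #|[set x | b x == c]|.+1.
  by rewrite sum_nat_const card_ord.
rewrite -[#|T|]sum1_card (partition_big b predT) //=.
by apply: leq_sum => i _; rewrite sum1dep_card.
Qed.

End Balancing.

(** * From weights to edit distance *)

Lemma edit_distance_le (T : finType) (G H : sgraph T) :
  (edit_distance G H <= \sum_u \sum_v (G u v (+) H u v))%N.
Proof.
have -> : (\sum_u \sum_v (G u v (+) H u v))%N =
    #|[set pr : T * T | G pr.1 pr.2 (+) H pr.1 pr.2]|.
  rewrite pair_big -sum1dep_card [RHS]big_mkcond /=.
  by apply: eq_bigr => pr _; case: (_ (+) _).
(* Each edge of the symmetric difference comes from two ordered pairs; the factor 2 is given
   away. *)
apply: leq_trans (leq_imset_card (fun pr : T * T => [set pr.1; pr.2]) _).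
apply/subset_leq_card/subsetP => e; rewrite inE.
have in_edges (K : sgraph T) u v : K u v -> [set u; v] \in edges K.
  by move=> Kuv; apply/imsetP; exists (u, v).
have [/imsetP[[u v] /= Guv ->]|nG] := boolP (e \in edges G) => /=.
  move=> nH; apply/imsetP; exists (u, v) => //; rewrite !inE /= in Guv *.
  by rewrite Guv /=; apply: contra nH => /in_edges.
move=> /imsetP[[u v] /= Huv eq_e]; apply/imsetP; exists (u, v) => //.
rewrite !inE /= in Huv *; rewrite Huv addbT.
by apply: contra nG; rewrite eq_e => /in_edges.
Qed.

Lemma multipartite_approx (R : realType) (T : finType) (G : sgraph T) (rho : R) :
    0 < rho <= 2^-1 -> (0 < #|T|)%N ->
    1 - (rho ^+ 2 / 3) ^+ 4 <= 2 * turan_graph_weight R G ->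
  exists (s : nat) (p : T -> 'I_s), [/\ (0 < s)%N,
    forall i, #|[set u | p u == i]|%:R / #|T|%:R <= s%:R^-1 + rho :> R,
    (\sum_u \sum_v (G u v (+) (p u != p v)))%:R <= 3 * rho * #|T|%:R ^+ 2 :> R &
    (\sum_u \sum_v ~~ G u v)%:R <= (s%:R^-1 + 2 * rho) * #|T|%:R ^+ 2 :> R].
Proof.
move=> /andP[rho_gt0 rho_le] T_gt0 le_w.
(* With 3 lam = rho^2, each class mass deviates from 1/s by at most rho. *)
pose n : R := #|T|%:R; pose lam := rho ^+ 2 / 3; pose x (_ : T) := n^-1.
have n_gt0 : 0 < n by rewrite ltr0n.
have n_ge0 := ltW n_gt0.
have x_ge0 u : 0 <= x u by rewrite invr_ge0.
have x_sum1 : \sum_u x u = 1.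
  by rewrite sumr_const -[LHS]mulr_natl mulfV // gt_eqF.
have lam_bnd : 0 < lam <= 2^-1.
  by rewrite divr_gt0 ?exprn_gt0 //=; rewrite /lam; nra.
have [|q [v [le_V vC le_M]]] := weighted_stability x_ge0 x_sum1 lam_bnd (G := G).
- by rewrite turan_graph_weightE in le_w.
set C := q @: [set: T] in le_V vC.
have qC u : q u \in C by rewrite imset_f.
pose s := #|C|; rewrite -/s in le_V; pose p u : 'I_s := enum_rank_in vC (q u).
have pE u w : (p u == p w) = (q u == q w).
  by apply/eqP/eqP => [/enum_rank_in_inj->|e] //; rewrite /p e.
have lam3 : 3 * lam = rho ^+ 2 by rewrite /lam; field.
have V_ge0 : 0 <= \sum_(c in C) (fibre_mass x q c - s%:R^-1) ^+ 2.
  by apply: sumr_ge0 => c _; rewrite sqr_ge0.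
have F_ge0 := fibre_weight_ge0 (R := R) G x_ge0 q [set: T].
have z_le c : c \in C -> fibre_mass x q c <= s%:R^-1 + rho.
  move=> cC; rewrite -lerBlDl; apply: le_trans (ler_norm _) _.
  rewrite -(@ler_pXn2r _ 2) ?nnegrE ?(ltW rho_gt0) // real_normK ?num_real //.
  rewrite -lam3; apply: le_trans le_V; rewrite (bigD1 c) //= addrCA lerDl.
  by rewrite addr_ge0 ?F_ge0 //; apply: sumr_ge0 => d _; rewrite sqr_ge0.
have sum_scale (F : T -> T -> nat) :
    (\sum_u \sum_w F u w)%:R = n ^+ 2 * \sum_u \sum_w x u * x w * (F u w)%:R.
  rewrite natr_sum mulr_sumr; apply: eq_bigr => u _.
  rewrite natr_sum mulr_sumr; apply: eq_bigr => w _.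
  by rewrite /x; field; rewrite gt_eqF.
have M_E : \sum_u x u * nonnbr_mass G x u =
    \sum_u \sum_w x u * x w * (~~ G u w)%:R.
  apply: eq_bigr => u _; rewrite mulr_sumr big_mkcond; apply: eq_bigr => w _ /=.
  by case: (G u w); rewrite ?mulr0 ?mulr1.
have M_le := le_trans le_M (lerD (z_le _ vC) (lexx _)).
rewrite lam3 M_E in M_le.
have rho2 : rho ^+ 2 <= rho / 2 by nra.
exists s, p; split.
- by rewrite card_gt0; apply/set0Pn; exists v.
- move=> i; apply: le_trans (z_le _ (enum_valP i)).
  rewrite /fibre_mass sumr_const -[leRHS]mulr_natl ler_wpM2r ?invr_ge0 //.
  rewrite ler_nat; apply/subset_leq_card/subsetP => u; rewrite !inE => /eqP <-.
  by apply/eqP; rewrite enum_rankK_in ?qC.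
- rewrite sum_scale mulrC ler_wpM2r ?exprn_ge0 //.
  (* Pair by pair, disagreement is 2 [same class, adjacent] + [non-adjacent] - [same class]. The
     last sum is at least 1/s and cancels the main term of the non-edge mass. *)
  have -> : \sum_u \sum_w x u * x w * (G u w (+) (p u != p w))%:R =
     2 * (\sum_u \sum_(w | q w == q u) x u * x w * (G u w)%:R) +
     \sum_u \sum_w x u * x w * (~~ G u w)%:R -
     \sum_u \sum_(w | q w == q u) x u * x w.
    rewrite mulr_sumr -big_split -sumrB; apply: eq_bigr => u _ /=.
    rewrite !(big_mkcond (fun w => q w == q u)) mulr_sumr -big_split -sumrB /=.
    apply: eq_bigr => w _; rewrite pE [q u == _]eq_sym.
    by case: (q w == q u); case: (G u w); rewrite /=; ring.
  rewrite -sum_fibre_mass_sqr -/C.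
  have := sum_fibre_mass_var x_sum1 q; rewrite /= -/C -/s => V_E.
  have : \sum_u \sum_(w | q w == q u) x u * x w * (G u w)%:R <=
         fibre_weight G x q [set: T].
    rewrite /fibre_weight; under [leRHS]eq_bigl do rewrite inE.
    apply: ler_sum => u _; under [leRHS]eq_bigl do rewrite inE.
    apply: ler_sum => w _; rewrite ler_wpM2l ?mulr_ge0 //.
    by have [/edge_weight_ge1|_] := boolP (G u w); rewrite ?edge_weight_ge0.
  by lra.
rewrite sum_scale mulrC ler_wpM2r ?exprn_ge0 //.
by lra.
Qed.

(** * Complete multipartite graphs and recolouring *)

Section PartiteGraph.
Variables (T : finType) (k : nat).
Implicit Types p b : T -> 'I_k.

Lemma partite_sym p : symmetric [rel u v | p u != p v].
Proof. by move=> u v; rewrite /= eq_sym. Qed.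

Lemma partite_irr p : irreflexive [rel u v | p u != p v].
Proof. by move=> u; rewrite /= eqxx. Qed.

Definition partite_graph p : sgraph T := SGraph (partite_sym p) (partite_irr p).

Lemma balanced_is_turan b : balanced b -> is_turan_graph k (partite_graph b).
Proof. by move=> /balancedP b_bal; exists b. Qed.

(** A pair changes its status only if one of its two ends is recoloured. *)
Lemma recolour_distance (G : sgraph T) p b :
  (\sum_u \sum_v (G u v (+) (b u != b v)) <=
   \sum_u \sum_v (G u v (+) (p u != p v)) + 2 * (#|T| * #|[set u | p u != b u]|))%N.
Proof.
have card_sum : (\sum_u (p u != b u))%N = #|[set u | p u != b u]|.
  rewrite -sum1dep_card [RHS]big_mkcond /=.
  by apply: eq_bigr => u _; case: (_ != _).
have row_sum : (\sum_(u : T) \sum_v (p v != b v))%N =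
    (#|T| * #|[set u | p u != b u]|)%N.
  by rewrite sum_nat_const card_sum.
have col_sum : (\sum_u \sum_(v : T) (p u != b u))%N =
    (#|T| * #|[set u | p u != b u]|)%N.
  by rewrite exchange_big.
rewrite mul2n -addnn -{1}row_sum -col_sum -!big_split /=.
apply: leq_sum => u _; rewrite -!big_split /=; apply: leq_sum => v _.
have [->|_] := eqVneq (p u) (b u); have [->|_] := eqVneq (p v) (b v) => //=;
  first by rewrite !addn0.
all: by rewrite (leq_trans (leq_b1 _)) // !addnA ?addn0 addn1.
Qed.

(** A class of [p] has at most n/k + rho n vertices and a class of [b] at least n/k - 1, so each of
    the k classes gives up at most 1 + rho n vertices. *)
Lemma rebalance_distance (R : realType) p (rho : R) :
    (0 < k)%N -> (0 < #|T|)%N -> 0 <= rho ->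
    (forall i, #|[set u | p u == i]|%:R / #|T|%:R <= k%:R^-1 + rho :> R) ->
  exists2 b, balanced b &
    #|[set u | p u != b u]|%:R <= k%:R * (1 + rho * #|T|%:R) :> R.
Proof.
move=> k_gt0 T_gt0 rho_ge0 p_le; have [b b_bal b_le] := rebalance k_gt0 p.
have kR_gt0 : 0 < k%:R :> R by rewrite ltr0n.
have nR_gt0 : 0 < #|T|%:R :> R by rewrite ltr0n.
exists b => //; rewrite -sum1dep_card (partition_big p predT) //= natr_sum.
have -> : k%:R * (1 + rho * #|T|%:R) = \sum_(i < k) (1 + rho * #|T|%:R).
  by rewrite sumr_const card_ord -[RHS]mulr_natl.
apply: ler_sum => i _; rewrite sum1dep_card.
have -> : [set u | (p u != b u) && (p u == i)] = [set u | (p u == i) && (b u != i)].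
  by apply/setP => u; rewrite !inE andbC; case: eqP => //= ->; rewrite eq_sym.
have := b_le i; set N := #|_|; set N1 := #|_|; set N2 := #|_| => le_N.
have [le12|lt21] := leqP N1 N2.
  move: le_N; rewrite (eqP (le12 : (N1 - N2 == 0)%N)) leqn0 => /eqP->.
  by rewrite addr_ge0 ?mulr_ge0 // ltW.
have {le_N} : N%:R <= N1%:R - N2%:R :> R by rewrite -natrB ?ler_nat // ltnW.
move=> /le_trans; apply; rewrite lerBlDr.
have := p_le i; rewrite ler_pdivrMr // mulrDl -/N1 => /le_trans; apply.
have := balanced_card i b_bal; rewrite -/N2 -(ler_nat R) natrM -natr1.
by rewrite -ler_pdivrMl //; lra.
Qed.

End PartiteGraph.

(** * Choice of constants and of the Turan graph *)

Theorem theorem1p7 (R : realType) (eps : R) (eps_gt0 : 0 < eps) :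
  exists (n0 : nat) (delta : R),
    0 < delta /\
    forall (T : finType) (G : sgraph T),
      (n0 <= #|T|)%N ->
      1 / 2 - delta <= turan_graph_weight R G ->
      exists (k : nat) (H : sgraph T),
        [/\ (0 < k)%N,
            is_turan_graph k H &
            (edit_distance G H)%:R <= eps * #|T|%:R ^+ 2].
Proof.
(* This rho makes s rho <= e/8 whenever e s < 4; capping e at 1 gives 32 rho <= e. *)
pose e := Num.min eps 1; pose rho := e ^+ 2 / 32.
have e_gt0 : 0 < e by rewrite lt_min eps_gt0 ltr01.
have e_le1 : e <= 1 by rewrite ge_min lexx orbT.
have e_le : e <= eps by rewrite ge_min lexx.
have e2_gt0 : 0 < e ^+ 2 by rewrite exprn_gt0.
have rho_gt0 : 0 < rho by rewrite divr_gt0.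
have rho_le : 32 * rho <= e by rewrite /rho; nra.
have rho_bnd : 0 < rho <= 2^-1 by rewrite rho_gt0 /=; lra.
(* From n >= 32/e^2 the rounding error s n is at most (e/8) n^2 when e s < 4. The halving in delta
   matches the factor 2 in [multipartite_approx]. *)
exists (Num.bound (32 / e ^+ 2)), ((rho ^+ 2 / 3) ^+ 4 / 2).
split=> [|T G le_n le_w]; first by rewrite !(divr_gt0, exprn_gt0).
have n_gt : 32 / e ^+ 2 < #|T|%:R.
  apply: lt_le_trans (archi_boundP _) _; last by rewrite ler_nat.
  by rewrite divr_ge0 // ltW.
have nR_gt0 : 0 < #|T|%:R :> R by apply: lt_trans n_gt; rewrite divr_gt0.
have nR_ge0 := ltW nR_gt0.
have T_gt0 : (0 < #|T|)%N by rewrite ltr0n in nR_gt0.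
have n2_gt0 : 0 < #|T|%:R ^+ 2 :> R by rewrite exprn_gt0.
have [|s [p [s_gt0 p_le dist_p nonedges]]] := multipartite_approx (G := G) rho_bnd T_gt0.
  by lra.
have sR_gt0 : 0 < s%:R :> R by rewrite ltr0n.
(* Many classes: there are at most (e/4 + 2 rho) n^2 ordered non-adjacent pairs, and the complete
   graph is T(n, n), with singleton classes. *)
have [s_big|s_small] := leP 4 (e * s%:R).
  exists #|T|, (partite_graph (fun u : T => enum_rank u)); split => //.
    apply/balanced_is_turan/balancedP => i j.
    apply: (@leq_trans 1%N) => //; apply/card_le1_eqP => u v.
    by rewrite !inE => /eqP<- /eqP/enum_rank_inj.
  have le_dist := edit_distance_le G (partite_graph (fun u : T => enum_rank u)).
  apply: (@le_trans _ _ (\sum_u \sum_v ~~ G u v)%N%:R).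
    rewrite ler_nat (leq_trans le_dist) //.
    apply: leq_sum => u _; apply: leq_sum => v _ /=.
    rewrite (inj_eq enum_rank_inj).
    by have [->|_] := eqVneq u v; rewrite ?adj_irr //= addbT.
  apply: le_trans nonedges _; rewrite ler_wpM2r ?ltW //.
  have : s%:R^-1 <= e / 4 by rewrite -[leLHS]mul1r ler_pdivrMr //; lra.
  by lra.
(* Few classes: [p] costs 3 rho n^2, and recolouring adds 2 s (n + rho n^2), at most (e/2) n^2. *)
have [b b_bal dist_b] := rebalance_distance s_gt0 T_gt0 (ltW rho_gt0) p_le.
exists s, (partite_graph b); split => //; first exact: balanced_is_turan.
have := leq_trans (edit_distance_le G (partite_graph b)) (recolour_distance G p b).
rewrite -(ler_nat R) natrD !natrM => /le_trans; apply.
have n_bnd : 32 <= e ^+ 2 * #|T|%:R by move: n_gt; rewrite ltr_pdivrMr // mulrC => /ltW.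
have D_le : #|T|%:R * #|[set u | p u != b u]|%:R <=
    #|T|%:R * (s%:R * (1 + rho * #|T|%:R)) :> R by rewrite ler_wpM2l.
have s_rho : s%:R * rho * #|T|%:R ^+ 2 <= e / 8 * #|T|%:R ^+ 2.
  rewrite ler_wpM2r ?(ltW n2_gt0) // /rho.
  have : (e * s%:R) * (e / 32) <= 4 * (e / 32) by rewrite ler_wpM2r ?divr_ge0 // ltW.
  by lra.
have s_n : s%:R * #|T|%:R <= e / 8 * #|T|%:R ^+ 2.
  by rewrite expr2 mulrA ler_wpM2r // -(ler_pM2l e_gt0); lra.
have : e * #|T|%:R ^+ 2 <= eps * #|T|%:R ^+ 2 by rewrite ler_wpM2r // ltW.
have : 32 * rho * #|T|%:R ^+ 2 <= e * #|T|%:R ^+ 2 by rewrite ler_wpM2r // ltW.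
have : 0 < e * #|T|%:R ^+ 2 by rewrite mulr_gt0.
by lra.
Qed.
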